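(* There exist positive integers $m,n$ and a fractional assignment $x \in [0,1]^{m \times n}$ such that for any assignment $y \in \{0,1\}^{m \times n}$, there exist some $i\in [m]$ and $1 \le s \le t \le n$ for which \[ \Big|\sum_{j \in [s,t]} (x_{ij} - y_{ij}) \Big| > 1. \]
   Context: $[k] := \{1,\dots,k\}$, and $[s,t]$ denotes the set of integers $j$ with $s\le j\le t$. A matrix $x \in [0,1]^{m \times n}$ is a fractional assignment if $\sum_{i \in [m]} x_{ij} = 1$ for every column $j \in [n]$. A matrix $y \in \{0,1\}^{m \times n}$ is an (integral) assignment if $\sum_{i \in [m]} y_{ij} = 1$ for every $j \in [n]$. *)

(* Defs.v *)
From mathcomp Require Import all_boot all_order all_algebra.
From mathcomp Require Import reals.

Set Implicit Arguments.
Unset Strict Implicit.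
Unset Printing Implicit Defensive.

Import Order.TTheory GRing.Theory Num.Theory.
Local Open Scope ring_scope.

Definition fractional_assignment (R : realType) (m n : nat) (x : 'M[R]_(m, n)) : Prop :=
  (forall i j, 0 <= x i j <= 1) /\ (forall j, \sum_(i < m) x i j = 1).

Definition integral_assignment (R : realType) (m n : nat) (y : 'M[R]_(m, n)) : Prop :=
  (forall i j, y i j = 0 \/ y i j = 1) /\ (forall j, \sum_(i < m) y i j = 1).

(* Main.v *)
(** A computer search produced a fractional assignment with three rows and ten
    columns, whose entries are multiples of 1/12.  Assign the columns from left
    to right, backtracking as soon as an interval ending at the last assigned
    column has discrepancy above 1: at most a hundred partial assignments survive,
    and none of them extends to all ten columns. *)

Require Import Defs.
From mathcomp Require Import all_boot all_order all_algebra.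
From mathcomp Require Import reals.

Import Order.TTheory GRing.Theory Num.Theory.
Local Open Scope ring_scope.

Fixpoint refuted (bad : pred (seq nat)) (m d : nat) (w : seq nat) : bool :=
  bad w || (if d is d'.+1
            then all (fun k => refuted bad m d' (rcons w k)) (iota 0 m)
            else false).

(** The values of [f] trace one branch of the search tree. A success of the search closes every
    branch, so this one meets a bad prefix after at most [d] further letters. *)
Lemma refutedP (bad : pred (seq nat)) (m d p : nat) (f : nat -> nat) :
  (forall j, f j < m)%N -> refuted bad m d (mkseq f p) ->
  exists2 q, (q <= p + d)%N & bad (mkseq f q).
Proof.
move=> f_lt; elim: d p => [|d IHd] p /= /orP[bad_p|//].
- by exists p; rewrite ?leq_addr.
- by exists p; rewrite ?leq_addr.
move=> /allP/(_ (f p)); rewrite mem_iota f_lt => /(_ isT).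
by rewrite -mkseqS => /IHd; rewrite addSnnS.
Qed.

(** This is |a - b| > N, written with additions because subtraction on [nat] truncates. *)
Definition far (N a b : nat) : bool := (N + b < a)%N || (N + a < b)%N.

(* [X i j / N] is the fractional entry, [w`_j] the row that receives column [j]. *)
Definition far_suffix (X : nat -> nat -> nat) (N m : nat) (w : seq nat) : bool :=
  has (fun s =>
    has (fun i =>
      far N (sumn [seq X i j | j <- iota s (size w - s)])
            (N * sumn [seq nat_of_bool (nth 0 w j == i)
                      | j <- iota s (size w - s)]))
    (iota 0 m))
  (iota 0 (size w)).

Lemma sum_ord_interval (V : nmodType) (n s t : nat) (F : nat -> V) : (t < n)%N ->
  \sum_(j < n | (s <= j <= t)%N) F j = \sum_(s <= j < t.+1) F j.
Proof.
move=> lt_tn; rewrite (big_nat_widen _ _ _ _ _ lt_tn) big_geq_mkord.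
by apply: eq_bigl => j; rewrite andbC /= ltnS.
Qed.

Lemma sumn_interval (R : pzSemiRingType) (F : nat -> nat) (s q : nat) :
  (sumn [seq F j | j <- iota s (q - s)])%:R = \sum_(s <= j < q) (F j)%:R :> R.
Proof. by rewrite sumnE big_map natr_sum. Qed.

Lemma far_norm (R : realType) (N a b : nat) : (0 < N)%N -> far N a (N * b) ->
  1 < `|a%:R / N%:R - b%:R : R|.
Proof.
move=> N_gt0 far_ab; have N_gt0R : 0 < N%:R :> R by rewrite ltr0n.
have -> : a%:R / N%:R - b%:R = (a%:R - (N * b)%:R) / N%:R :> R.
  by rewrite mulrBl natrM mulrAC mulfV ?gt_eqF// mul1r.
rewrite normrM normfV (gtr0_norm N_gt0R) ltr_pdivlMr // mul1r ltr_normr.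
case/orP: far_ab => lt_ab; apply/orP; [left | right].
  by rewrite ltrBrDr -natrD ltr_nat.
by rewrite opprB ltrBrDr -natrD ltr_nat.
Qed.

Lemma integral_assignment_choice (R : realType) (m n : nat) (y : 'M[R]_(m, n)) :
  integral_assignment y ->
  exists c : 'I_n -> 'I_m, forall i j, y i j = (c j == i)%:R.
Proof.
move=> [y01 sum_y].
have ex1 j : exists i, y i j == 1.
  apply/existsP; apply: contraT => /existsPn y_neq1.
  have := sum_y j; rewrite big1 => [/eqP|i _]; first by rewrite eq_sym oner_eq0.
  by case: (y01 i j) => // /eqP; rewrite (negbTE (y_neq1 i)).
exists (fun j => xchoose (ex1 j)) => i j.
have /eqP yc := xchooseP (ex1 j); set c := xchoose _ in yc *.
case: eqVneq => [<- //|neq_ci].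
case: (y01 i j) => // yi; have := sum_y j.
(* A second 1 in column [j], at row [i], is impossible: cancelling the 1 at [c] leaves 1 plus
   nonnegative terms equal to 0. *)
rewrite (bigD1 c) //= yc (bigD1 i) 1?eq_sym //= yi -[RHS]addr0 => /addrI/eqP.
rewrite gt_eqF // ltr_wpDr // sumr_ge0 // => k _.
by case: (y01 k j) => ->.
Qed.

Lemma refuted_discrepancy (R : realType) (m n N : nat) (X : nat -> nat -> nat)
    (y : 'M[R]_(m, n)) :
  (0 < m)%N -> (0 < N)%N ->
  refuted (far_suffix X N m) m n [::] -> integral_assignment y ->
  exists (i : 'I_m) (s t : 'I_n), (s <= t)%N /\
    1 < `| \sum_(j < n | (s <= j <= t)%N) ((X i j)%:R / N%:R - y i j) |.
Proof.
move=> m_gt0 N_gt0 refX /integral_assignment_choice[c yE].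
(* The search lemma wants a total function on [nat]. Beyond column [n] the default row 0 is legal
   since [m] is positive. *)
pose f j : nat := oapp (fun k => c k : nat) 0%N (insub j).
have f_lt j : (f j < m)%N by rewrite /f; case: insub => [k|] //=.
have fE (j : 'I_n) : f j = c j by rewrite /f valK.
(* The empty prefix has no interval and is never bad. A bad prefix thus has length [q.+1], and its
   last column [q] serves as [t]. *)
have [[//|q] le_qn] := refutedP _ _ _ 0%N _ f_lt refX.
rewrite /far_suffix size_mkseq => /hasP[s + /hasP[i]].
rewrite !mem_iota /= !add0n => lt_sq lt_im /(far_norm R _ _ _ N_gt0).
rewrite !sumn_interval => far_i.
exists (Ordinal lt_im), (Ordinal (leq_trans lt_sq le_qn)), (Ordinal le_qn).
split; rewrite //=.
rewrite (eq_bigr (fun j : 'I_n => (X i j)%:R / N%:R - (f j == i)%:R)); last first.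
  by move=> j _; rewrite yE fE.
rewrite (sum_ord_interval _ _ _ _ (fun j => (X i j)%:R / N%:R - (f j == i)%:R)) //.
rewrite big_split sumrN -mulr_suml /=; move: far_i.
congr (_ < `|_ - _|); apply: eq_big_nat => j /andP[_ lt_jq].
by rewrite nth_mkseq.
Qed.

Definition witness (i j : nat) : nat :=
  nth 0%N (nth [::]
    [:: [:: 6; 0; 0; 0; 7; 6; 6; 8; 2; 3];
        [:: 2; 7; 11; 9; 1; 5; 4; 1; 6; 0];
        [:: 4; 5; 1; 3; 4; 1; 2; 3; 4; 9]]%N i) j.

(** Scaling by 12 keeps every test in [nat], so the whole search is a closed computation that does
    not mention [R]. *)
Lemma witness_refuted : refuted (far_suffix witness 12 3) 3 10 [::].
Proof. by vm_compute. Qed.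

Theorem proposition5 (R : realType) :
  exists (m n : nat) (x : 'M[R]_(m, n)),
    [/\ (0 < m)%N, (0 < n)%N, fractional_assignment x &
      forall y : 'M[R]_(m, n), integral_assignment y ->
        exists (i : 'I_m) (s t : 'I_n),
          (s <= t)%N /\
          1 < `| \sum_(j < n | (s <= j <= t)%N) (x i j - y i j) |].
Proof.
exists 3%N, 10%N, (\matrix_(i, j) ((witness i j)%:R / 12%:R)).
have col_sum (j : 'I_10) : (\sum_(i < 3) witness i j = 12)%N.
  by rewrite !big_ord_recr big_ord0; case: j; do 10?case=> //.
split=> //.
  split=> [i j|j].
    rewrite mxE divr_ge0 ?ler0n //= ler_pdivrMr ?ltr0n // mul1r ler_nat.
    (* A numerator is at most its column sum 12, the other numerators being natural numbers. *)
    by rewrite -(col_sum j) (bigD1 i) //= leq_addr.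
  under eq_bigr do rewrite mxE.
  by rewrite -mulr_suml -natr_sum col_sum mulfV // pnatr_eq0.
move=> y int_y.
have [i [s [t [le_st disc]]]] :=
  refuted_discrepancy R 3 10 12 _ y isT isT witness_refuted int_y.
exists i, s, t; split=> //.
by under eq_bigr do rewrite mxE.
Qed.
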